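(* Let $X$ be a path-connected topological space with base point $x_0\in X$ and let $H\leq \pi_1(X,x_0)$. Suppose that the fiber $p_H^{-1}(x_0)$ is $T_1$ and that for every $x\in X$ and for every path $\beta:[0,1]\rightarrow X$ from $\beta(0)=x$ to $\beta(1)=x_0$, the standard monodromy $\phi_\beta:p_H^{-1}(x)\rightarrow p_H^{-1}(x_0)$ is continuous. Then $p_H:\widetilde{X}_H\rightarrow X$ has unique path lifting.
   Context: Paths are continuous maps from $[0,1]$; $\alpha\cdot\gamma$ denotes concatenation of paths, $\beta^-(t)=\beta(1-t)$ the reverse path, and $[\,\cdot\,]$ the homotopy class relative to endpoints. Construction of $p_H:\widetilde{X}_H\to X$: On the set of all paths $\alpha:([0,1],0)\rightarrow (X,x_0)$ (paths starting at $x_0$), let $\alpha\sim\beta$ if and only if $\alpha(1)=\beta(1)$ and $[\alpha\cdot\beta^-]\in H$. The equivalence class of $\alpha$ is denoted $\langle\alpha\rangle$, and $\widetilde{X}_H$ is the set of all equivalence classes. It carries the topology generated by the basis elements $\langle\alpha,U\rangle=\{\langle\alpha\cdot\gamma\rangle\mid \gamma:([0,1],0)\rightarrow (U,\alpha(1))\text{ a path}\}$, where $U\subseteq X$ is open and $\langle\alpha\rangle\in\widetilde{X}_H$ with $\alpha(1)\in U$. The map $p_H:\widetilde{X}_H\rightarrow X$ is the (continuous) endpoint projection $p_H(\langle\alpha\rangle)=\alpha(1)$. Fibers $p_H^{-1}(x)$ carry the subspace topology. Standard monodromy: for a path $\beta:[0,1]\to X$ from $x$ to $y$, $\phi_\beta:p_H^{-1}(x)\rightarrow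 p_H^{-1}(y)$ is the bijection $\phi_\beta(\langle\alpha\rangle)=\langle\alpha\cdot\beta\rangle$ (not necessarily continuous). Unique path lifting: whenever $f,g:[0,1]\to\widetilde{X}_H$ are paths with $p_H\circ f=p_H\circ g$ and $f(0)=g(0)$, then $f=g$. *)

(* Defs.v *)
From HB Require Import structures.
From mathcomp Require Import all_boot all_order all_algebra generic_quotient.
From mathcomp Require Import monoid.
From mathcomp Require Import all_classical reals.
From mathcomp Require Import topology normedtype continuous_path.
From mathcomp Require Import ring lra.

Set Implicit Arguments.
Unset Strict Implicit.
Unset Printing Implicit Defensive.

Import Order.TTheory GRing.Theory Num.Theory.
Import numFieldNormedType.Exports.

Local Open Scope classical_set_scope.
Local Open Scope ring_scope.
Local Open Scope quotient_scope.

Definition unit_interval (R : realType) : Type := (`[0, 1]%classic : set R).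

Section UnitInterval.
Context {R : realType}.
Local Notation I := (unit_interval R).

HB.instance Definition _ := Topological.copy I (`[0, 1]%classic : set R).

Definition ival (t : I) : R := set_val t.

Fact proj01_subproof (x : R) :
  Num.min 1 (Num.max 0 x) \in (`[0, 1]%classic : set R).
Proof.
apply/mem_set; rewrite /= in_itv /= ge_min lexx /= le_min ler01 /=.
by rewrite le_max lexx.
Qed.

(* Truncation of a real number to [0, 1]; see [proj01K]. *)
Definition proj01 (x : R) : I :=
  exist (fun y : R => y \in `[0, 1]%classic) _ (proj01_subproof x).

Lemma ival_ge0 t : 0 <= ival t.
Proof. by have := set_valP t; rewrite /= in_itv /= => /andP[]. Qed.

Lemma ival_le1 t : ival t <= 1.
Proof. by have := set_valP t; rewrite /= in_itv /= => /andP[]. Qed.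

Lemma ival_inj : injective ival.
Proof. exact: val_inj. Qed.

Lemma proj01K x : 0 <= x <= 1 -> ival (proj01 x) = x.
Proof. by move=> /andP[x0 x1]; rewrite /ival set_valE /= max_r// min_r. Qed.

Lemma ivalK t : proj01 (ival t) = t.
Proof. by apply: ival_inj; rewrite proj01K// ival_ge0 ival_le1. Qed.

Fact zero_one_subproof : proj01 0 != proj01 1.
Proof.
apply/eqP => /(congr1 ival); rewrite !proj01K ?lexx ?ler01//.
by move/eqP; rewrite eq_sym oner_eq0.
Qed.

HB.instance Definition _ := isBiPointed.Build I zero_one_subproof.

Lemma ival0 : ival zero = 0.
Proof. by rewrite proj01K// lexx ler01. Qed.

Lemma ival1 : ival one = 1.
Proof. by rewrite proj01K// lexx ler01. Qed.

Lemma proj01_0 : proj01 0 = zero. Proof. by []. Qed.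

Lemma proj01_1 : proj01 1 = one. Proof. by []. Qed.

Lemma proj01_le0 (x : R) : x <= 0 -> proj01 x = zero.
Proof.
move=> x0; apply: ival_inj; rewrite ival0 /proj01 /ival set_valE /=.
by rewrite max_l// min_r.
Qed.

Lemma proj01_ge1 (x : R) : 1 <= x -> proj01 x = one.
Proof.
move=> x1; apply: ival_inj; rewrite ival1 /proj01 /ival set_valE /=.
by rewrite min_l// le_max x1 orbT.
Qed.

Lemma ival_continuous : continuous ival.
Proof. exact: (@initial_continuous _ _ set_val). Qed.

Lemma proj01_continuous : continuous proj01.
Proof.
apply: (@continuous_comp_initial _ _ _ (set_val : I -> R)) => x.
apply: (@continuous_min R R (cst 1) (fun x : R => Num.max 0 x)).
  exact: cvg_cst.
by apply: (@continuous_max R R (cst 0) idfun); [exact: cvg_cst|exact: cvg_id].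
Qed.

Lemma continuous_compose (S T U : topologicalType) (f : S -> T) (g : T -> U) :
  continuous f -> continuous g -> continuous (fun x => g (f x)).
Proof. by move=> cf cg x; exact: (continuous_comp (cf x) (cg (f x))). Qed.

Lemma continuous_fst (S T : topologicalType) : continuous (@fst S T).
Proof. by move=> x; exact: cvg_fst. Qed.

Lemma continuous_snd (S T : topologicalType) : continuous (@snd S T).
Proof. by move=> x; exact: cvg_snd. Qed.

Lemma continuous_pair (S T U : topologicalType) (f : S -> T) (g : S -> U) :
  continuous f -> continuous g -> continuous (fun x => (f x, g x)).
Proof. by move=> cf cg x; exact: cvg_pair (cf x) (cg x). Qed.

Lemma proj01_comp_continuous (T : topologicalType) (h : T -> R) :
  continuous h -> continuous (fun t => proj01 (h t)).
Proof.
move=> ch; apply: (@continuous_compose _ _ _ h proj01) => //.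
exact: proj01_continuous.
Qed.

Lemma affine_ival_continuous (a b : R) :
  continuous (fun t : I => proj01 (a * ival t + b)).
Proof.
apply: proj01_comp_continuous.
apply: (@continuous_compose _ _ _ ival (fun x : R => a * x + b)).
  exact: ival_continuous.
move=> x; apply: cvgD; last exact: cvg_cst.
by apply: cvgM; [exact: cvg_cst|exact: cvg_id].
Qed.

Lemma double_continuous : continuous (fun t : I => proj01 (2 * ival t)).
Proof.
rewrite (_ : (fun t => _) = fun t : I => proj01 (2 * ival t + 0)).
  exact: affine_ival_continuous.
by apply/funext => t; rewrite addr0.
Qed.

Lemma flip_continuous : continuous (fun t : I => proj01 (1 - ival t)).
Proof.
rewrite (_ : (fun t => _) = fun t : I => proj01 (-1 * ival t + 1)).
  exact: affine_ival_continuous.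
by apply/funext => t; rewrite mulN1r addrC.
Qed.

Lemma glue_continuous (T U : topologicalType) (b : T -> R) (c : R)
    (h1 h2 : T -> U) :
  continuous b -> continuous h1 -> continuous h2 ->
  (forall t, b t = c -> h1 t = h2 t) ->
  continuous (fun t => if b t <= c then h1 t else h2 t).
Proof.
move=> cb /continuous_closedP c1 /continuous_closedP c2 h12.
apply/continuous_closedP => C cC.
have cA : closed [set t | b t <= c].
  by move/continuous_closedP: (cb) => /(_ _ (@closed_le R c)).
have cB : closed [set t | c <= b t].
  by move/continuous_closedP: (cb) => /(_ _ (@closed_ge R c)).
rewrite (_ : _ @^-1` C = ([set t | b t <= c] `&` h1 @^-1` C) `|`
  ([set t | c <= b t] `&` h2 @^-1` C)).
  by apply: closedU; apply: closedI => //; [exact: c1|exact: c2].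
apply/seteqP; split=> t /=.
  by case: ifPn => bt Ct; [left|right; split=> //; rewrite ltW// ltNge].
case: ifPn => bt [[hb hC]|[hb hC]] //.
by rewrite h12//; apply/eqP; rewrite eq_le bt.
Qed.

End UnitInterval.

Section Paths.
Context {R : realType} {X : topologicalType}.
Local Notation I := (unit_interval R).

(* [chain_path] has a wedge of intervals as its domain, so that it cannot be
   iterated within paths on [0, 1]; this is the usual concatenation. In each
   branch the argument of [proj01] lies in [0, 1]. *)
Definition path_concat (f g : I -> X) (t : I) : X :=
  if ival t <= 2^-1 then f (proj01 (2 * ival t))
  else g (proj01 (2 * ival t - 1)).

Section Concat.
Context (x y z : X) (p : {path I from x to y}) (q : {path I from y to z}).

Fact path_concat_continuous : continuous (path_concat p q).
Proof.
apply: glue_continuous => [| | |t ->].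
- exact: ival_continuous.
- by apply: continuous_compose; [exact: double_continuous|exact: cts_fun].
- by apply: continuous_compose; [exact: affine_ival_continuous|exact: cts_fun].
- by rewrite divff ?pnatr_eq0// subrr proj01_0 proj01_1 path_zero path_one.
Qed.

Fact path_concat_zero : path_concat p q zero = x.
Proof.
by rewrite /path_concat ival0 invr_ge0 ler0n mulr0 proj01_0 path_zero.
Qed.

Fact path_concat_one : path_concat p q one = z.
Proof.
rewrite /path_concat ival1 ifF; last by apply/negbTE; rewrite -ltNge; lra.
by rewrite (_ : 2 * 1 - 1 = 1) ?proj01_1 ?path_one//; ring.
Qed.

HB.instance Definition _ :=
  isContinuous.Build I X (path_concat p q) path_concat_continuous.
HB.instance Definition _ :=
  isPath.Build I X x z (path_concat p q) path_concat_zero path_concat_one.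

Definition concat : {path I from x to z} := path_concat p q.

End Concat.

Definition path_reverse (f : I -> X) (t : I) : X := f (proj01 (1 - ival t)).

Section Reverse.
Context (x y : X) (p : {path I from x to y}).

Fact path_reverse_continuous : continuous (path_reverse p).
Proof.
by apply: continuous_compose; [exact: flip_continuous|exact: cts_fun].
Qed.

Fact path_reverse_zero : path_reverse p zero = y.
Proof. by rewrite /path_reverse ival0 subr0 proj01_1 path_one. Qed.

Fact path_reverse_one : path_reverse p one = x.
Proof. by rewrite /path_reverse ival1 subrr proj01_0 path_zero. Qed.

HB.instance Definition _ :=
  isContinuous.Build I X (path_reverse p) path_reverse_continuous.
HB.instance Definition _ :=
  isPath.Build I X y x (path_reverse p) path_reverse_zero path_reverse_one.

Definition reverse : {path I from y to x} := path_reverse p.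

End Reverse.

Definition const_path (x : X) : {path I from x to x} := cst x.

(* The same map, with its endpoint replaced by a propositionally equal one. *)
Definition recast (x y z : X) (p : {path I from x to y}) (e : y = z) :
  {path I from x to z} := mk_path (@cts_fun _ _ p) path_zero (etrans path_one e).

Lemma recast_erefl (x y : X) (p : {path I from x to y}) :
  recast p erefl = p.
Proof. exact/path_eqP. Qed.

Section Homotopy.
Context (x y : X).
Implicit Types p q r : {path I from x to y}.

(* Homotopy relative to the endpoints. *)
Definition homotopic p q := exists F : (I * I)%type -> X,
  [/\ continuous F,
      forall s, F (s, zero) = p s,
      forall s, F (s, one) = q s,
      forall t, F (zero, t) = x &
      forall t, F (one, t) = y].

Lemma eq_homotopic p q : p =1 q -> homotopic p q.
Proof.
move=> pq; exists (fun st => p st.1); split=> // [|t|t].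
- apply: (@continuous_compose _ _ _ fst p); last exact: cts_fun.
  exact: continuous_fst.
- by rewrite path_zero.
- by rewrite path_one.
Qed.

Lemma homotopic_sym p q : homotopic p q -> homotopic q p.
Proof.
move=> [F [cF F0 F1 Fx Fy]].
exists (fun st => F (st.1, proj01 (1 - ival st.2))); split=> // [|s|s].
- apply: (@continuous_compose _ _ _ (fun st : I * I =>
    (st.1, proj01 (1 - ival st.2))) F) => //.
  apply: continuous_pair; first exact: continuous_fst.
  apply: (@continuous_compose _ _ _ snd (fun t : I => proj01 (1 - ival t))).
    exact: continuous_snd.
  exact: flip_continuous.
- by rewrite /= ival0 subr0 proj01_1.
- by rewrite /= ival1 subrr proj01_0.
Qed.

Lemma homotopic_trans q p r : homotopic p q -> homotopic q r -> homotopic p r.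
Proof.
move=> [F [cF F0 F1 Fx Fy]] [G [cG G0 G1 Gx Gy]].
exists (fun st => if ival st.2 <= 2^-1 then F (st.1, proj01 (2 * ival st.2))
                  else G (st.1, proj01 (2 * ival st.2 - 1))).
split=> [|s|s|t|t].
- apply: (@glue_continuous _ _ _ (fun st : I * I => ival st.2)).
  + apply: (@continuous_compose _ _ _ snd); last exact: ival_continuous.
    exact: continuous_snd.
  + apply: (@continuous_compose _ _ _ (fun st : I * I =>
      (st.1, proj01 (2 * ival st.2))) F) => //.
    apply: continuous_pair; first exact: continuous_fst.
    apply: (@continuous_compose _ _ _ snd (fun t : I => proj01 (2 * ival t))).
      exact: continuous_snd.
    exact: double_continuous.
  + apply: (@continuous_compose _ _ _ (fun st : I * I =>
      (st.1, proj01 (2 * ival st.2 - 1))) G) => //.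
    apply: continuous_pair; first exact: continuous_fst.
    apply: (@continuous_compose _ _ _ snd (fun t : I => proj01 (2 * ival t - 1))).
      exact: continuous_snd.
    exact: affine_ival_continuous.
  + move=> [s t] /= ->.
    by rewrite divff ?pnatr_eq0// subrr proj01_0 proj01_1 F1 G0.
- by rewrite /= ival0 invr_ge0 ler0n mulr0 proj01_0 F0.
- rewrite /= ival1 ifF; last by apply/negbTE; rewrite -ltNge; lra.
  by rewrite (_ : 2 * 1 - 1 = 1) ?proj01_1 ?G1//; ring.
- by rewrite /= Fx Gx if_same.
- by rewrite /= Fy Gy if_same.
Qed.

End Homotopy.

Lemma reparam_homotopic (x y u v : X) (p : {path I from x to y})
    (q r : {path I from u to v}) (phi psi : I -> I) :
  continuous phi -> continuous psi ->
  phi zero = psi zero -> phi one = psi one ->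
  (forall s, q s = p (phi s)) -> (forall s, r s = p (psi s)) -> homotopic q r.
Proof.
move=> cphi cpsi e0 e1 qE rE.
pose h (st : I * I) : R :=
  (1 - ival st.2) * ival (phi st.1) + ival st.2 * ival (psi st.1).
have ch : continuous h.
  have c2 : continuous (fun st : I * I => ival st.2).
    apply: (@continuous_compose _ _ _ snd); last exact: ival_continuous.
    exact: continuous_snd.
  have c1 (f : I -> I) : continuous f ->
      continuous (fun st : I * I => ival (f st.1)).
    move=> cf; apply: (@continuous_compose _ _ _ fst (fun s => ival (f s))).
      exact: continuous_fst.
    by apply: continuous_compose => //; exact: ival_continuous.
  move=> st; apply: cvgD; apply: cvgM.
  - by apply: cvgB; [exact: cvg_cst|exact: c2].
  - exact: c1.
  - exact: c2.
  - exact: c1.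
exists (fun st => p (proj01 (h st))); split=> [|s|s|t|t].
- by apply: continuous_compose; [exact: proj01_comp_continuous|exact: cts_fun].
- by rewrite /h /= ival0 subr0 mul1r mul0r addr0 ivalK qE.
- by rewrite /h /= ival1 subrr mul0r mul1r add0r ivalK rE.
- by rewrite /h /= -e0 -mulrDl subrK mul1r ivalK -qE path_zero.
- by rewrite /h /= -e1 -mulrDl subrK mul1r ivalK -qE path_one.
Qed.

Lemma concat_homotopic (x y z : X) (p p' : {path I from x to y})
    (q q' : {path I from y to z}) :
  homotopic p p' -> homotopic q q' -> homotopic (concat p q) (concat p' q').
Proof.
move=> [F [cF F0 F1 Fx Fy]] [G [cG G0 G1 Gx Gy]].
exists (fun st => if ival st.1 <= 2^-1 then F (proj01 (2 * ival st.1), st.2)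
                  else G (proj01 (2 * ival st.1 - 1), st.2)).
split=> [|s|s|t|t].
- apply: (@glue_continuous _ _ _ (fun st : I * I => ival st.1)).
  + apply: (@continuous_compose _ _ _ fst); last exact: ival_continuous.
    exact: continuous_fst.
  + apply: (@continuous_compose _ _ _ (fun st : I * I =>
      (proj01 (2 * ival st.1), st.2)) F) => //.
    apply: continuous_pair; last exact: continuous_snd.
    apply: (@continuous_compose _ _ _ fst (fun t : I => proj01 (2 * ival t))).
      exact: continuous_fst.
    exact: double_continuous.
  + apply: (@continuous_compose _ _ _ (fun st : I * I =>
      (proj01 (2 * ival st.1 - 1), st.2)) G) => //.
    apply: continuous_pair; last exact: continuous_snd.
    apply: (@continuous_compose _ _ _ fst (fun t : I => proj01 (2 * ival t - 1))).
      exact: continuous_fst.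
    exact: affine_ival_continuous.
  + move=> [s t] /= ->.
    by rewrite divff ?pnatr_eq0// subrr proj01_0 proj01_1 Fy Gx.
- by rewrite /= F0 G0.
- by rewrite /= F1 G1.
- by rewrite /= ival0 invr_ge0 ler0n mulr0 proj01_0 Fx.
- rewrite /= ival1 ifF; last by apply/negbTE; rewrite -ltNge; lra.
  by rewrite (_ : 2 * 1 - 1 = 1) ?proj01_1 ?Gy//; ring.
Qed.

Lemma reverse_homotopic (x y : X) (p q : {path I from x to y}) :
  homotopic p q -> homotopic (reverse p) (reverse q).
Proof.
move=> [F [cF F0 F1 Fx Fy]].
exists (fun st => F (proj01 (1 - ival st.1), st.2)); split=> [|s|s|t|t].
- apply: (@continuous_compose _ _ _ (fun st : I * I =>
    (proj01 (1 - ival st.1), st.2)) F) => //.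
  apply: continuous_pair; last exact: continuous_snd.
  apply: (@continuous_compose _ _ _ fst (fun t : I => proj01 (1 - ival t))).
    exact: continuous_fst.
  exact: flip_continuous.
- by rewrite /= F0.
- by rewrite /= F1.
- by rewrite /= ival0 subr0 proj01_1 Fy.
- by rewrite /= ival1 subrr proj01_0 Fx.
Qed.

Section Groupoid.
Context (w x y z : X).
Implicit Types (p : {path I from w to x}) (q : {path I from x to y})
  (r : {path I from y to z}).

Lemma minR_continuous (f g : R -> R) : continuous f -> continuous g ->
  continuous (fun t => Num.min (f t) (g t)).
Proof. by move=> cf cg t; exact: (@continuous_min R R f g t (cf t) (cg t)). Qed.

Lemma affine_continuous (a b : R) : continuous (fun t : R => a * t + b).
Proof.
move=> t; apply: cvgD; last exact: cvg_cst.
by apply: cvgM; [exact: cvg_cst|exact: cvg_id].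
Qed.

Lemma reparam_continuous (f : R -> R) :
  continuous f -> continuous (fun t : I => proj01 (f (ival t))).
Proof.
move=> cf; apply: proj01_comp_continuous.
by apply: (@continuous_compose _ _ _ ival f) => //; exact: ival_continuous.
Qed.

Lemma id_continuous : continuous (@id I).
Proof. by move=> t; exact: cvg_id. Qed.

Lemma concatA p q r :
  homotopic (concat (concat p q) r) (concat p (concat q r)).
Proof.
pose f (t : R) := Num.min (2 * t + 0) (Num.min (1 * t + 4^-1) (2^-1 * t + 2^-1)).
have fE1 t : 0 <= t <= 4^-1 -> f t = 2 * t.
  by move=> ?; rewrite /f minEle ifT ?addr0// le_min; apply/andP; split; lra.
have fE2 t : 4^-1 <= t <= 2^-1 -> f t = t + 4^-1.
  move=> ?; rewrite /f [Num.min (1 * t + _) _]minEle ifT; last lra.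
  by rewrite minEge ifT ?mul1r//; lra.
have fE3 t : 2^-1 <= t <= 1 -> f t = 2^-1 * t + 2^-1.
  move=> ?; rewrite /f [Num.min (1 * t + _) _]minEge ifT; last lra.
  by rewrite minEge ifT//; lra.
apply: (@reparam_homotopic _ _ _ _ (concat p (concat q r)) _ _
  (fun t => proj01 (f (ival t))) id) => //.
- apply: reparam_continuous; apply: minR_continuous; first exact: affine_continuous.
  by apply: minR_continuous; exact: affine_continuous.
- exact: id_continuous.
- by rewrite ival0 fE1 ?mulr0//; lra.
- rewrite ival1 fE3; last lra.
  by rewrite (_ : 2^-1 * 1 + 2^-1 = 1)//; lra.
move=> s; rewrite /concat /= /path_concat /=.
have s0 := ival_ge0 s; have s1 := ival_le1 s.
case: (leP (ival s) 2^-1) => hs.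
  rewrite /path_concat proj01K; last lra.
  case: (leP (2 * ival s) 2^-1) => h2.
    rewrite fE1; last lra.
    rewrite proj01K; last lra.
    by rewrite ifT//; lra.
  rewrite fE2; last lra.
  rewrite proj01K; last lra.
  rewrite ifF; last by apply/negbTE; rewrite -ltNge; lra.
  rewrite /path_concat proj01K; last lra.
  rewrite ifT; last lra.
  by congr (q (proj01 _)); lra.
rewrite fE3; last lra.
rewrite proj01K; last lra.
rewrite ifF; last by apply/negbTE; rewrite -ltNge; lra.
rewrite /path_concat proj01K; last lra.
rewrite ifF; last by apply/negbTE; rewrite -ltNge; lra.
by congr (r (proj01 _)); lra.
Qed.

Lemma concat_const_l p : homotopic (concat (const_path w) p) p.
Proof.
apply: (@reparam_homotopic _ _ _ _ p _ _
  (fun t => proj01 (2 * ival t - 1)) id) => //.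
- exact: affine_ival_continuous.
- exact: id_continuous.
- by rewrite ival0 proj01_le0//; lra.
- by rewrite ival1 (_ : 2 * 1 - 1 = 1)//; ring.
move=> s; rewrite /concat /= /path_concat.
case: ifP => // hs; rewrite [in RHS]proj01_le0 ?path_zero//; lra.
Qed.

Lemma concat_const_r p : homotopic (concat p (const_path x)) p.
Proof.
apply: (@reparam_homotopic _ _ _ _ p _ _
  (fun t => proj01 (2 * ival t)) id) => //.
- exact: double_continuous.
- exact: id_continuous.
- by rewrite ival0 mulr0.
- by rewrite ival1 proj01_ge1//; lra.
move=> s; rewrite /concat /= /path_concat.
case: (leP (ival s) 2^-1) => // hs; rewrite [in RHS]proj01_ge1 ?path_one//; lra.
Qed.

Lemma concat_reverse_r p : homotopic (concat p (reverse p)) (const_path w).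
Proof.
apply: (@reparam_homotopic _ _ _ _ p _ _
  (fun t => proj01 (Num.min (2 * ival t + 0) (-2 * ival t + 2)))
  (fun=> zero)) => //.
- apply: (@reparam_continuous (fun t => Num.min (2 * t + 0) (-2 * t + 2))).
  by apply: minR_continuous; exact: affine_continuous.
- exact: cst_continuous.
- by rewrite ival0 minEle ifT ?mulr0 ?addr0//; lra.
- by rewrite ival1 minEge ifT ?mulr1 ?addNr//; lra.
- move=> s; have s0 := ival_ge0 s; have s1 := ival_le1 s.
  rewrite /concat /= /path_concat.
  case: (leP (ival s) 2^-1) => hs.
    by rewrite minEle ifT ?addr0//; lra.
  rewrite minEge ifT; last lra.
  rewrite /reverse /= /path_reverse proj01K; last lra.
  by congr (p (proj01 _)); ring.
- by move=> s; rewrite path_zero.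
Qed.

Lemma reverseK p : reverse (reverse p) =1 p.
Proof.
move=> t; have t0 := ival_ge0 t; have t1 := ival_le1 t.
rewrite /reverse /= /path_reverse /= /path_reverse proj01K; last lra.
by rewrite (_ : 1 - (1 - ival t) = ival t) ?ivalK//; ring.
Qed.

Lemma reverse_concat p q :
  reverse (concat p q) =1 concat (reverse q) (reverse p).
Proof.
move=> t; have t0 := ival_ge0 t; have t1 := ival_le1 t.
rewrite /reverse /concat /= /path_reverse /= /path_concat proj01K; last lra.
case: (ltgtP (ival t) 2^-1) => ht.
- rewrite ifF; last by apply/negbTE; rewrite -ltNge; lra.
  rewrite proj01K; last lra.
  by congr (q (proj01 _)); ring.
- rewrite ifT; last lra.
  rewrite proj01K; last lra.
  by congr (p (proj01 _)); ring.
- rewrite ht ifT; last lra.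
  rewrite (_ : 2 * 2^-1 = 1); last lra.
  rewrite (_ : 2 * (1 - 2^-1) = 1); last lra.
  by rewrite proj01_1 ival1 subrr proj01_0 path_zero path_one.
Qed.

End Groupoid.

Lemma concat_reverse_l (w x : X) (p : {path I from w to x}) :
  homotopic (concat (reverse p) p) (const_path x).
Proof.
apply: homotopic_trans (concat_reverse_r (reverse p)).
by apply: concat_homotopic; apply: eq_homotopic => // t; rewrite reverseK.
Qed.

Section PathClass.
Context (x y : X).

Definition homotopicb (p q : {path I from x to y}) : bool := `[< homotopic p q >].

Fact homotopicb_refl : reflexive homotopicb.
Proof. by move=> p; apply/asboolP; exact: eq_homotopic. Qed.

Fact homotopicb_sym : symmetric homotopicb.
Proof. by move=> p q; apply/asboolP/asboolP; exact: homotopic_sym. Qed.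

Fact homotopicb_trans : transitive homotopicb.
Proof.
move=> q p r /asboolP pq /asboolP qr; apply/asboolP.
exact: homotopic_trans pq qr.
Qed.

Canonical homotopic_equiv :=
  EquivRel homotopicb homotopicb_refl homotopicb_sym homotopicb_trans.

Definition path_class : Type := {eq_quot homotopic_equiv}.
HB.instance Definition _ := Choice.on path_class.
HB.instance Definition _ := EqQuotient.on path_class.

Definition class_of_path (p : {path I from x to y}) : path_class :=
  \pi_path_class p.

Lemma class_of_pathP p q : class_of_path p = class_of_path q <-> homotopic p q.
Proof. by split=> [/eqmodP/asboolP//|pq]; apply/eqmodP/asboolP. Qed.

Lemma class_of_path_repr (a : path_class) : class_of_path (repr a) = a.
Proof. exact: reprK. Qed.

End PathClass.
End Paths.

Definition pi1 (R : realType) (X : topologicalType) (x0 : X) : Type :=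
  path_class (R := R) x0 x0.

Section FundamentalGroup.
Context {R : realType} {X : topologicalType} (x0 : X).
Local Notation G := (pi1 R x0).
Implicit Types a b c : G.

HB.instance Definition _ := Choice.on G.

(* The operations are computed on representatives; [pi1_mul_class] and
   [pi1_inv_class] show that they are induced by those on loops. *)
Definition pi1_one : G := class_of_path (const_path x0).
Definition pi1_mul a b : G := class_of_path (concat (repr a) (repr b)).
Definition pi1_inv a : G := class_of_path (reverse (repr a)).

Local Notation loop := {path (unit_interval R) from x0 to x0}.

Lemma repr_homotopic (p : loop) : homotopic (repr (class_of_path p)) p.
Proof. by apply/class_of_pathP; rewrite class_of_path_repr. Qed.

Lemma pi1_mul_class (p q : loop) :
  pi1_mul (class_of_path p) (class_of_path q) = class_of_path (concat p q).
Proof.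
by apply/class_of_pathP; apply: concat_homotopic; exact: repr_homotopic.
Qed.

Lemma pi1_inv_class (p : loop) :
  pi1_inv (class_of_path p) = class_of_path (reverse p).
Proof.
by apply/class_of_pathP; apply: reverse_homotopic; exact: repr_homotopic.
Qed.

Fact pi1_mulA : associative pi1_mul.
Proof.
move=> a b c; rewrite -[a]class_of_path_repr -[b]class_of_path_repr.
rewrite -[c]class_of_path_repr !pi1_mul_class.
by apply/class_of_pathP/homotopic_sym; exact: concatA.
Qed.

Fact pi1_mul1 : left_id pi1_one pi1_mul.
Proof.
move=> a; rewrite -[a]class_of_path_repr pi1_mul_class.
by apply/class_of_pathP; exact: concat_const_l.
Qed.

Fact pi1_mulr1 : right_id pi1_one pi1_mul.
Proof.
move=> a; rewrite -[a]class_of_path_repr pi1_mul_class.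
by apply/class_of_pathP; exact: concat_const_r.
Qed.

Fact pi1_mulV : left_inverse pi1_one pi1_inv pi1_mul.
Proof.
move=> a; rewrite -[a]class_of_path_repr pi1_inv_class pi1_mul_class.
by apply/class_of_pathP; exact: concat_reverse_l.
Qed.

Fact pi1_mulrV : right_inverse pi1_one pi1_inv pi1_mul.
Proof.
move=> a; rewrite -[a]class_of_path_repr pi1_inv_class pi1_mul_class.
by apply/class_of_pathP; exact: concat_reverse_r.
Qed.

HB.instance Definition _ :=
  isGroup.Build G pi1_mulA pi1_mul1 pi1_mulr1 pi1_mulV pi1_mulrV.

Lemma mul_class (p q : loop) :
  ((class_of_path p : G) * (class_of_path q : G))%g = class_of_path (concat p q).
Proof. exact: pi1_mul_class. Qed.

Lemma inv_class (p : loop) :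
  ((class_of_path p : G)^-1)%g = class_of_path (reverse p).
Proof. exact: pi1_inv_class. Qed.

Lemma one_class : (1 : G)%g = class_of_path (const_path x0).
Proof. by []. Qed.

End FundamentalGroup.

Section Cover.
Context {R : realType} {X : topologicalType} {x0 : X}.
Local Notation I := (unit_interval R).

(* A path with a free endpoint, bundled with that endpoint. *)
Definition based_path : Type := {y : X & {path I from x0 to y}}.
HB.instance Definition _ := gen_eqMixin based_path.
HB.instance Definition _ := gen_choiceMixin based_path.
HB.instance Definition _ :=
  isPointed.Build based_path (existT _ x0 (const_path x0)).

Definition mk_based (y : X) (p : {path I from x0 to y}) : based_path :=
  existT _ y p.
Definition end_point (a : based_path) : X := projT1 a.
Definition path_of (a : based_path) : {path I from x0 to end_point a} :=
  projT2 a.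

Context (H : groupClosed (pi1 R x0)).

(* [a] and [b] have the same endpoint and the class of the loop a . b^- is
   in H; the first path is recast so that this loop is well-typed. *)
Definition cover_rel (a b : based_path) : Prop :=
  exists e : end_point a = end_point b,
    (class_of_path (concat (recast (path_of a) e) (reverse (path_of b)))
      : pi1 R x0) \in H.

Lemma cover_relP (y : X) (p q : {path I from x0 to y}) :
  cover_rel (mk_based p) (mk_based q) <->
  (class_of_path (concat p (reverse q)) : pi1 R x0) \in H.
Proof.
split=> [[/= e]|h]; last by exists erefl; rewrite recast_erefl.
by rewrite (Prop_irrelevance e erefl) recast_erefl.
Qed.

Definition cover_relb (a b : based_path) : bool := `[< cover_rel a b >].

Fact cover_rel_refl : reflexive cover_relb.
Proof.
move=> [y p]; apply/asboolP/cover_relP.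
suff -> : class_of_path (concat p (reverse p)) = (1 : pi1 R x0)%g.
  exact: gpred1.
by apply/class_of_pathP; exact: concat_reverse_r.
Qed.

Lemma cover_rel_symP a b : cover_rel a b -> cover_rel b a.
Proof.
case: a b => [y p] [z q] [/= e]; case: _ / e q => q.
rewrite recast_erefl => h; apply/cover_relP.
suff -> : class_of_path (concat q (reverse p)) =
    ((class_of_path (concat p (reverse q)) : pi1 R x0)^-1)%g by rewrite gpredV.
rewrite inv_class; apply/class_of_pathP/homotopic_sym.
apply: (@homotopic_trans _ _ _ _ (concat (reverse (reverse q)) (reverse p))).
  by apply: eq_homotopic => t; exact: reverse_concat.
by apply: concat_homotopic; apply: eq_homotopic => // t; exact: reverseK.
Qed.

Fact cover_rel_sym : symmetric cover_relb.
Proof. by move=> a b; apply/asboolP/asboolP; exact: cover_rel_symP. Qed.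

Fact cover_rel_trans : transitive cover_relb.
Proof.
move=> [z q] [y p] [w r] /asboolP[/= e1]; case: _ / e1 q => q pq.
move=> /asboolP[/= e2]; case: _ / e2 r => r qr.
apply/asboolP/cover_relP; move: pq qr; rewrite !recast_erefl => pq qr.
suff -> : class_of_path (concat p (reverse r)) =
    ((class_of_path (concat p (reverse q)) : pi1 R x0) *
     (class_of_path (concat q (reverse r)) : pi1 R x0))%g by exact: gpredM.
rewrite mul_class; apply/class_of_pathP/homotopic_sym.
apply: homotopic_trans (concatA _ _ _) _.
apply: concat_homotopic; first exact: eq_homotopic.
apply: homotopic_trans (homotopic_sym (concatA _ _ _)) _.
apply: homotopic_trans (concat_const_l _).
by apply: concat_homotopic; [exact: concat_reverse_l|exact: eq_homotopic].
Qed.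

Canonical cover_equiv :=
  EquivRel cover_relb cover_rel_refl cover_rel_sym cover_rel_trans.

Definition cover_space : Type := {eq_quot cover_equiv}.
HB.instance Definition _ := Choice.on cover_space.
HB.instance Definition _ := EqQuotient.on cover_space.

Definition cover_class (a : based_path) : cover_space := \pi_cover_space a.

Lemma cover_classP a b : cover_class a = cover_class b <-> cover_rel a b.
Proof. by split=> [/eqmodP/asboolP//|ab]; apply/eqmodP/asboolP. Qed.

Lemma cover_class_repr (u : cover_space) : cover_class (repr u) = u.
Proof. exact: reprK. Qed.

Definition cover_proj (u : cover_space) : X := end_point (repr u).

Lemma cover_projE a : cover_proj (cover_class a) = end_point a.
Proof. by have /cover_classP[e _] := cover_class_repr (cover_class a). Qed.

(* <a, U>, meaningful when U is open and contains the endpoint of [a]. *)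
Definition cover_basis (a : based_path) (U : set X) : set cover_space :=
  [set u | exists z (g : {path I from end_point a to z}),
    range g `<=` U /\ u = cover_class (mk_based (concat (path_of a) g))].

Lemma homotopic_cover_class (y : X) (p q : {path I from x0 to y}) :
  homotopic p q -> cover_class (mk_based p) = cover_class (mk_based q).
Proof.
move=> pq; apply/cover_classP/cover_relP.
suff -> : class_of_path (concat p (reverse q)) = (1 : pi1 R x0)%g.
  exact: gpred1.
apply/class_of_pathP; apply: homotopic_trans (concat_reverse_r q).
by apply: concat_homotopic => //; exact: eq_homotopic.
Qed.

Lemma cover_class_concat (y z : X) (p q : {path I from x0 to y})
    (r : {path I from y to z}) :
  cover_class (mk_based p) = cover_class (mk_based q) ->
  cover_class (mk_based (concat p r)) = cover_class (mk_based (concat q r)).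
Proof.
move=> /cover_classP/cover_relP pq; apply/cover_classP/cover_relP.
suff -> : class_of_path (concat (concat p r) (reverse (concat q r))) =
  class_of_path (concat p (reverse q)) by [].
apply/class_of_pathP; apply: homotopic_trans (concatA _ _ _) _.
apply: concat_homotopic; first exact: eq_homotopic.
apply: (@homotopic_trans _ _ _ _ (concat r (concat (reverse r) (reverse q)))).
  apply: concat_homotopic; apply: eq_homotopic => // t.
  exact: reverse_concat.
apply: homotopic_trans (homotopic_sym (concatA _ _ _)) _.
apply: homotopic_trans (concat_const_l _).
by apply: concat_homotopic; [exact: concat_reverse_r|exact: eq_homotopic].
Qed.

Lemma range_concat (x y z : X) (p : {path I from x to y}) (q : {path I from y to z})
  (U : set X) : range p `<=` U -> range q `<=` U -> range (concat p q) `<=` U.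
Proof.
move=> pU qU _ [t _ <-]; rewrite /concat /= /path_concat.
by case: ifP => _; [apply: pU|apply: qU]; eexists.
Qed.

Definition basis_index : set (based_path * set X) :=
  [set aU | open aU.2 /\ aU.2 (end_point aU.1)].

Fact cover_basis_cover :
  \bigcup_(aU in basis_index) cover_basis aU.1 aU.2 = setT.
Proof.
apply/seteqP; split=> // u _; exists (repr u, setT) => /=.
  by split=> //; exact: openT.
exists (end_point (repr u)), (const_path _); split=> //.
rewrite -{1}[u]cover_class_repr; case: (repr u) => y p.
by apply: homotopic_cover_class; apply: homotopic_sym; exact: concat_const_r.
Qed.

Lemma cover_basis_shift (a : based_path) (z w : X)
    (g : {path I from end_point a to z}) (d : {path I from x0 to z})
    (h : {path I from z to w}) :
  cover_class (mk_based d) = cover_class (mk_based (concat (path_of a) g)) ->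
  cover_class (mk_based (concat d h)) =
  cover_class (mk_based (concat (path_of a) (concat g h))).
Proof.
move=> /(cover_class_concat h) ->.
by apply: homotopic_cover_class; exact: concatA.
Qed.

Fact cover_basis_join (aU bV : based_path * set X) (u : cover_space) :
  basis_index aU -> basis_index bV ->
  cover_basis aU.1 aU.2 u -> cover_basis bV.1 bV.2 u ->
  exists cW, [/\ basis_index cW, cover_basis cW.1 cW.2 u &
    cover_basis cW.1 cW.2 `<=` cover_basis aU.1 aU.2 `&` cover_basis bV.1 bV.2].
Proof.
move: aU bV => [a U] [b V] [/= oU Ua] [/= oV Vb] [z [g [gU ->]]].
move=> [z' [g' [gV /[dup] e /cover_classP[/= ez _]]]].
case: _ / ez g' gV e => g' gV e.
exists (mk_based (concat (path_of a) g), U `&` V); split.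
- split; first exact: openI.
  split; rewrite /= -[z](path_one (s := g)); first by apply: gU; exists one.
  by rewrite path_one -(path_one (s := g')); apply: gV; exists one.
- exists z, (const_path z); split.
    move=> _ [t _ <-]; rewrite /= /const_path /=; split.
      by rewrite -(path_one (s := g)); apply: gU; exists one.
    by rewrite -(path_one (s := g')); apply: gV; exists one.
  by apply: homotopic_cover_class; apply: homotopic_sym; exact: concat_const_r.
move=> _ [w [h [hUV ->]]]; split; exists w.
- exists (concat g h); split; last exact: cover_basis_shift.
  by apply: range_concat => // x /hUV[].
- exists (concat g' h); split; last exact: cover_basis_shift.
  by apply: range_concat => // x /hUV[].
Qed.

HB.instance Definition _ :=
  isBaseTopological.Build cover_space cover_basis_cover cover_basis_join.

Lemma open_cover_spaceE (A : set cover_space) :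
  open A = exists2 D, D `<=` basis_index &
                      \bigcup_(aU in D) cover_basis aU.1 aU.2 = A.
Proof. by []. Qed.

(* As a type, a fiber carries the subspace topology. *)
Definition cover_fiber (x : X) : set cover_space := cover_proj @^-1` [set x].

Section Monodromy.
Context (x y : X) (beta : {path I from x to y}).

Fact fiber_end_point (u : cover_fiber x) : end_point (repr (val u)) = x.
Proof. by have := set_valP u. Qed.

(* The class <a> is sent to <a . beta>, with [a] a chosen representative;
   [monodromyE] shows that any other one gives the same value. *)
Definition monodromy_rep (u : cover_fiber x) : based_path :=
  mk_based (concat (recast (path_of (repr (val u))) (fiber_end_point u)) beta).

Fact monodromy_subproof (u : cover_fiber x) :
  cover_class (monodromy_rep u) \in cover_fiber y.
Proof. by apply/mem_set; rewrite /cover_fiber /= cover_projE. Qed.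

Definition monodromy (u : cover_fiber x) : cover_fiber y :=
  exist (fun v => v \in cover_fiber y) _ (monodromy_subproof u).

Lemma monodromyE (p : {path I from x0 to x}) (u : cover_fiber x) :
  val u = cover_class (mk_based p) ->
  val (monodromy u) = cover_class (mk_based (concat p beta)).
Proof.
move=> uE; have cE : cover_class (repr (val u)) = cover_class (mk_based p).
  by rewrite cover_class_repr.
rewrite /monodromy /= /monodromy_rep; move: (fiber_end_point u) cE.
move: (repr (val u)) => [z q] e; move: p beta {uE}; case: _ / e => p' beta'.
by rewrite recast_erefl; exact: cover_class_concat.
Qed.

End Monodromy.
End Cover.

Arguments based_path {R X} x0.
Arguments cover_rel {R X x0} H a b.
Arguments cover_space {R X x0} H.
Arguments cover_class {R X x0} H a.
Arguments cover_proj {R X x0} H u.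
Arguments cover_basis {R X x0} H a U.
Arguments cover_fiber {R X x0} H x.
Arguments monodromy {R X x0} H {x y} beta u.

Definition path_connected (R : realType) (X : topologicalType) :=
  forall x y : X, inhabited {path (unit_interval R) from x to y}.

Definition unique_path_lifting (R : realType) (E X : topologicalType)
    (p : E -> X) :=
  forall f g : unit_interval R -> E, continuous f -> continuous g ->
    p \o f = p \o g -> f zero = g zero -> f = g.

(* Main.v *)
Require Import Defs.
From mathcomp Require Import all_boot all_algebra monoid.
From mathcomp Require Import all_classical reals.
From mathcomp Require Import topology normedtype continuous_path.
From mathcomp Require Import order lra.

(** Let [f] be a lift of the path [b], fix a time [t1] and a path [d] from
    [b t1] to [x0]. Carry each [f s] along the rest of [b] up to [t1] and then
    along [d]: this gives a function [transported] from the unit interval to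
    the fiber over [x0]. At [s = t1] its value is [f t1] carried along [d]; at
    [s = 0] it is the standard lift of [b] at time [t1], carried along [d].
    Since transport along [d] is injective ([cover_class_cancel]), [f t1] is
    determined by [b] and [f 0] as soon as [transported] is constant. Two lifts
    that start at the same point then agree ([lift_endE]).

    It is continuous ([transported_continuous]): if [f s] is the class of [p]
    and [t] is close to [s], then [f t] is the class of [p . g] with [g] in a
    small open set [V], and [b] stays in [V] between [t] and [s]. Following
    [b] from [t] back to [s] closes [g] into a loop [w] in [V], and the value
    at [t] is the image of the class of [p . w], a point of the fiber over
    [b s] close to [f s], under the monodromy that defines the value at [s].
    That one monodromy map is continuous by assumption.

    It is then constant, although T1 alone would not force this: for a fixed
    open set [U] containing the base point of a fiber, the traces on the fiber
    of the sets <a, U> with [a] ending in [U] partition it, so they are clopen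
    ([fiber_basis_clopen]). In a T1 fiber they separate points, so
    connectedness of the interval applies ([path_in_fiber_constant]). *)

Set Implicit Arguments.
Unset Strict Implicit.
Unset Printing Implicit Defensive.

Import Order.TTheory GRing.Theory Num.Theory.
Import numFieldNormedType.Exports.

Local Open Scope classical_set_scope.

(** * Subpaths of a path *)

Section Subpaths.
Context {R : realType}.
Local Notation I := (unit_interval R).
Local Open Scope ring_scope.

(** Nothing forces [s <= t]: the same formula runs a path forward, along the
    rest of its course, and backward, to close up a nearby path. *)
Definition segment_map (s t u : I) : I :=
  proj01 ((ival t - ival s) * ival u + ival s).

Lemma segment_map_continuous s t : continuous (segment_map s t).
Proof. exact: affine_ival_continuous. Qed.

Lemma segment_map_zero s t : segment_map s t zero = s.
Proof. by rewrite /segment_map ival0 mulr0 add0r ivalK. Qed.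

Lemma segment_map_one s t : segment_map s t one = t.
Proof. by rewrite /segment_map ival1 mulr1 subrK ivalK. Qed.

Definition segment (s t : I) : {path I from s to t} :=
  mk_path (@segment_map_continuous s t) (segment_map_zero s t)
    (segment_map_one s t).

Lemma segment_ball (s t u : I) (e : R) :
  `|ival t - ival s| < e -> `|ival (segment t s u) - ival s| < e.
Proof.
move=> ts; rewrite /segment /= /mk_path /segment_map.
have := (ival_ge0 s, ival_le1 s); have := (ival_ge0 t, ival_le1 t).
have := (ival_ge0 u, ival_le1 u).
move: (ival s) (ival t) (ival u) ts => x y z xy [z0 z1] [y0 y1] [x0 x1].
rewrite proj01K; last by apply/andP; split; nra.
apply: le_lt_trans xy.
have -> : (x - y) * z + y - x = (y - x) * (1 - z) by lra.
by rewrite normrM ler_piMr// ger0_norm; lra.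
Qed.

Lemma nbhs_unit_interval (s : I) (A : set I) : open A -> A s ->
  exists2 e : R, 0 < e & forall t, `|ival t - ival s| < e -> A t.
Proof.
move=> [B oB <-] Bs.
have [e /= e0 sB] : nbhs_ball (ival s) B.
  by rewrite nbhs_ballE; exact: open_nbhs_nbhs.
by exists e => // t ts; apply: sB; rewrite /ball /= distrC.
Qed.

Lemma unit_interval_connected : connected [set: I].
Proof.
have -> : [set: I] = proj01 @` [set: R].
  by apply/seteqP; split=> // t _; exists (ival t) => //; exact: ivalK.
apply: connected_continuous_connected; first exact/connected_intervalP.
by apply: continuous_subspaceT; exact: proj01_continuous.
Qed.

Context {X : topologicalType} {b : I -> X} (cb : continuous b).

Definition subpath (s t : I) : {path I from b s to b t} :=
  mk_path (continuous_compose (@cts_fun _ _ (segment s t)) cb)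
    (f_equal b (path_zero (s := segment s t)))
    (f_equal b (path_one (s := segment s t))).

(** Both sides are reparametrizations of [b] by paths of the interval from [s]
    to [u], and any two such paths are homotopic because the interval is
    convex. *)
Lemma subpath_concat (s t u : I) :
  homotopic (concat (subpath s t) (subpath t u)) (subpath s u).
Proof.
apply: (@reparam_homotopic _ _ _ _ _ _ (mk_path cb erefl erefl) _ _
  (concat (segment s t) (segment t u)) (segment s u)) => //.
- exact: cts_fun.
- exact: cts_fun.
- by rewrite !path_zero.
- by rewrite !path_one.
- by move=> w; rewrite /concat /= /path_concat; case: ifP.
Qed.

Lemma subpath_refl (s : I) : homotopic (subpath s s) (const_path (b s)).
Proof.
apply: eq_homotopic => w.
by rewrite /= /mk_path /= /mk_path /segment_map subrr mul0r add0r ivalK.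
Qed.

(** Balls of the interval are convex, so the whole subpath stays close to
    [b s] once [t] does. *)
Lemma near_subpath (s : I) (V : set X) : open V -> V (b s) ->
  \forall t \near s, range (subpath t s) `<=` V.
Proof.
move=> oV Vs.
have oA : open (b @^-1` V) by move/continuousP: cb; exact.
have [e e0 eV] := @nbhs_unit_interval s _ oA Vs.
have : \forall t \near s, `|ival t - ival s| < e.
  move/cvgrPdist_lt: (@ival_continuous R s) => /(_ _ e0).
  by apply: filterS => t; rewrite distrC.
by apply: filterS => t ts _ [u _ <-]; apply: eV; exact: segment_ball.
Qed.

End Subpaths.

(** * Basic open sets of the covering space and of its fibers *)

Section CoverTopology.
Context {R : realType} {X : topologicalType} {x0 : X}.
Local Notation I := (unit_interval R).
Context (H : groupClosed (pi1 R x0)).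
Implicit Types (a c : based_path (R := R) x0) (U : set X).

Lemma cover_basis_self a U : U (end_point a) ->
  cover_basis H a U (cover_class H a).
Proof.
case: a => y p Uy; exists y, (const_path y); split; first by move=> _ [t _ <-].
by apply: homotopic_cover_class; apply: homotopic_sym; exact: concat_const_r.
Qed.

(** If <c> = <a . g> with [g] in [U], an extension of [c] inside [U] extends
    [a] by a path that still lies in [U]. *)
Lemma cover_basis_sub a c U :
  cover_basis H a U (cover_class H c) ->
  cover_basis H c U `<=` cover_basis H a U.
Proof.
move=> [z [g [gU /[dup] e /cover_classP[/= ez _]]]].
case: c ez e => y d /= ez; case: _ / ez g gU => g gU e _ [w [h [hU ->]]].
exists w, (concat g h); split; first exact: range_concat.
exact: cover_basis_shift.
Qed.

(** If <c> = <a . g>, then <a> = <c . g^-> and [g^-] lies in [U] with [g]. *)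
Lemma cover_basis_sym a c U :
  cover_basis H a U (cover_class H c) -> cover_basis H c U (cover_class H a).
Proof.
move=> [z [g [gU /[dup] e /cover_classP[/= ez _]]]].
case: c ez e => y d /= ez; case: _ / ez g gU => g gU e.
exists (end_point a), (reverse g); split.
  by move=> _ [t _ <-]; apply: gU; eexists.
rewrite (cover_class_concat (reverse g) e).
case: a g gU e => x p /= g _ _; apply: homotopic_cover_class.
apply: homotopic_sym; apply: homotopic_trans (concatA _ _ _) _.
apply: homotopic_trans (concat_const_r _).
by apply: concat_homotopic; [exact: eq_homotopic|exact: concat_reverse_r].
Qed.

Lemma open_cover_basis a U : open U -> U (end_point a) ->
  open (cover_basis H a U).
Proof.
move=> oU Ua; rewrite open_cover_spaceE; exists [set (a, U)].
  by move=> _ ->.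
by rewrite bigcup_set1.
Qed.

(** A basic set is also basic around each of its points, so a neighborhood
    can be chosen centered at any prescribed representative. *)
Lemma cover_basis_nbhs (A : set (cover_space H)) c :
  open A -> A (cover_class H c) ->
  exists V, [/\ open V, V (end_point c) & cover_basis H c V `<=` A].
Proof.
rewrite open_cover_spaceE => -[D sD <-] [[a V] DaV /= aVc].
have [/= oV Va] := sD _ DaV; exists V; split => //.
  case: aVc => z [g [gV /cover_classP[/= ez _]]].
  by rewrite ez -(path_one (s := g)); apply: gV; exists one.
by move=> u cu; exists (a, V) => //; exact: (cover_basis_sub aVc).
Qed.

Lemma cover_proj_continuous : continuous (cover_proj H : cover_space H -> X).
Proof.
move=> u B; rewrite {1}nbhsE => -[U [oU Uu] UB].
have nu : nbhs u (cover_basis H (repr u) U).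
  apply: open_nbhs_nbhs; split; first exact: open_cover_basis.
  by rewrite -{2}[u]cover_class_repr; exact: cover_basis_self.
apply: filterS nu => _ [z [g [gU ->]]]; apply: UB.
rewrite cover_projE; apply: gU; exists one => //.
by rewrite path_one.
Qed.

(** By [cover_basis_sub] and [cover_basis_sym], basic sets over the same [U]
    are equal or disjoint; since [x] lies in [U], those over [U] cover the fiber
    over [x], so the complement of one of them is a union of others. *)
Lemma fiber_basis_clopen (x : X) a U : open U -> U (end_point a) -> U x ->
  clopen [set v : cover_fiber H x | cover_basis H a U (val v)].
Proof.
move=> oU Ua Ux; split.
  by exists (cover_basis H a U) => //; exact: open_cover_basis.
rewrite -openC.
exists (\bigcup_(c in [set c | U (end_point c) /\
    ~ cover_basis H a U (cover_class H c)]) cover_basis H c U).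
  by apply: bigcup_open => c [Uc _]; exact: open_cover_basis.
have Uv (v : cover_fiber H x) : U (end_point (repr (val v))).
  by have := set_valP v; rewrite /cover_fiber /= /cover_proj => ->.
apply/seteqP; split=> v /=.
  move=> [c [Uc nc] cv] av; apply: nc; move: cv av.
  rewrite set_valE /= -(cover_class_repr (sval v)) => cv av.
  by apply: (cover_basis_sub av); apply: cover_basis_sym.
move=> nv; exists (repr (val v)).
  by split; [exact: Uv|rewrite cover_class_repr].
rewrite set_valE /= -{2}(cover_class_repr (sval v)).
exact/cover_basis_self/Uv.
Qed.

(** A T1 space with a base of clopen sets is totally separated: the preimage
    under [k] of a clopen set around [k s] that misses [k t] would disconnect
    the interval. *)
Lemma path_in_fiber_constant (x : X) (k : I -> cover_fiber H x) :
  accessible_space (cover_fiber H x) -> continuous k -> forall s t, k s = k t.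
Proof.
move=> T1 ck s t; apply: contrapT => /eqP /T1[_ [[A oA <-]]].
move=> /set_mem As /set_mem nAt.
pose c := repr (val (k s)); have cE : cover_class H c = val (k s).
  exact: cover_class_repr.
move: As; rewrite /= set_valE /= -cE => /(cover_basis_nbhs oA)[V [oV Vc VA]].
have Vx : V x by rewrite -[x](set_valP (k s)).
have [oC cC] := @fiber_basis_clopen x c V oV Vc Vx.
pose B := k @^-1` [set v | cover_basis H c V (val v)].
suff BT : B = setT by apply: nAt; apply: VA; have : B t by rewrite BT.
apply: unit_interval_connected.
- by exists s; rewrite /B /= -cE; exact: cover_basis_self.
- by exists B; [move/continuousP: ck; exact|rewrite setTI].
- by exists B; [move/continuous_closedP: ck; exact|rewrite setTI].
Qed.

Lemma cover_class_cancel (y z : X) (p q : {path I from x0 to y})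
    (r : {path I from y to z}) :
  cover_class H (mk_based (concat p r)) =
    cover_class H (mk_based (concat q r)) ->
  cover_class H (mk_based p) = cover_class H (mk_based q).
Proof.
have K (o : {path I from x0 to y}) : cover_class H (mk_based o) =
    cover_class H (mk_based (concat (concat o r) (reverse r))).
  apply: homotopic_cover_class; apply: homotopic_sym.
  apply: homotopic_trans (concatA _ _ _) _.
  apply: homotopic_trans (concat_const_r _).
  by apply: concat_homotopic; [exact: eq_homotopic|exact: concat_reverse_r].
by move=> /(cover_class_concat (reverse r)); rewrite -!K.
Qed.

End CoverTopology.

(** * Transporting a lift into one fiber *)

Section Lifts.
Context {R : realType} {X : topologicalType} {x0 : X}.
Local Notation I := (unit_interval R).
Context (H : groupClosed (pi1 R x0)).
Context {b : I -> X} (cb : continuous b).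
Context {f : I -> cover_space H} (cf : continuous f).
Context (fb : forall s, cover_proj H (f s) = b s).
Context (t1 : I) (d : {path I from b t1 to x0}).

Definition lift_fiber (s : I) : cover_fiber H (b s) :=
  exist (fun v => v \in cover_fiber H (b s)) (f s) (mem_set (fb s)).

Definition transported (s : I) : cover_fiber H x0 :=
  monodromy H (concat (subpath cb s t1) d) (lift_fiber s).

Lemma transportedE s (p : {path I from x0 to b s}) :
  f s = cover_class H (mk_based p) ->
  val (transported s) =
  cover_class H (mk_based (concat p (concat (subpath cb s t1) d))).
Proof. by move=> fp; apply: monodromyE. Qed.

Lemma lift_repr s : exists p : {path I from x0 to b s},
  f s = cover_class H (mk_based p).
Proof.
rewrite -(fb s) -[f s]cover_class_repr cover_projE.
by exists (path_of (repr (f s))); case: (repr (f s)).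
Qed.

Context (cphi : forall s,
  continuous (monodromy H (concat (subpath cb s t1) d) :
                cover_fiber H (b s) -> cover_fiber H x0)).

Lemma transported_continuous : continuous (transported : I -> cover_fiber H x0).
Proof.
move=> s; have [p fp] := lift_repr s.
pose phi : cover_fiber H (b s) -> cover_fiber H x0 :=
  monodromy H (concat (subpath cb s t1) d).
move=> B /=; rewrite {1}nbhsE => -[O [oO Os] OB].
suff : \forall t \near s, O (transported t).
  by apply: filterS => t Ot; exact: OB.
have [A oA AO] : open (phi @^-1` O) by move/continuousP: (@cphi s); exact.
have As : A (cover_class H (mk_based p)).
  have : (phi @^-1` O) (lift_fiber s) by [].
  by rewrite -AO /= set_valE /= fp.
have [V [oV Vs VA]] := @cover_basis_nbhs _ _ _ _ _ _ oA As.
have nf : \forall t \near s, cover_basis H (mk_based p) V (f t).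
  suff : nbhs (f s) (cover_basis H (mk_based p) V) by move/cf.
  apply: open_nbhs_nbhs; split; first exact: open_cover_basis.
  by rewrite fp; exact: cover_basis_self.
have ns := near_subpath cb oV Vs.
near=> t.
have [z [g [gV ft]]] : cover_basis H (mk_based p) V (f t) by near: t.
have stV : range (subpath cb t s) `<=` V by near: t.
have ez : z = b t by rewrite -fb ft cover_projE.
subst z.
(* The loop [w] at [b s] lies in [V]; [transported t] is the image of
   <p . w> under the monodromy [phi] of time [s]. *)
pose w := concat g (subpath cb t s).
have wfib : cover_class H (mk_based (concat p w)) \in cover_fiber H (b s).
  by apply/mem_set; rewrite /cover_fiber /= cover_projE.
pose v : cover_fiber H (b s) :=
  exist (fun u => u \in cover_fiber H (b s)) _ wfib.
have -> : transported t = phi v.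
  apply: val_inj.
  rewrite (transportedE ft) (@monodromyE _ _ _ _ _ _ _ (concat p w))//.
  apply: homotopic_cover_class.
  apply: homotopic_trans (concatA _ _ _) _; apply: homotopic_sym.
  apply: homotopic_trans (concatA _ _ _) _.
  apply: concat_homotopic; first exact: eq_homotopic.
  apply: homotopic_trans (concatA _ _ _) _.
  apply: concat_homotopic; first exact: eq_homotopic.
  apply: homotopic_trans (homotopic_sym (concatA _ _ _)) _.
  by apply: concat_homotopic; [exact: subpath_concat|exact: eq_homotopic].
suff : (phi @^-1` O) v by [].
rewrite -AO /= set_valE /=; apply: VA; exists (b s), w; split => //.
exact: range_concat.
Unshelve. all: by end_near.
Qed.

Context (T1 : accessible_space (cover_fiber H x0)).

(** Comparison of [transported] at the times [t1] and [0]: it identifies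
    [f t1] with a class that depends on [b] and [p] only. *)
Lemma lift_endE (p : {path I from x0 to b zero}) :
  f zero = cover_class H (mk_based p) ->
  f t1 = cover_class H (mk_based (concat p (subpath cb zero t1))).
Proof.
move=> fp; have [q fq] := lift_repr t1.
rewrite fq; apply: (@cover_class_cancel _ _ _ _ _ _ _ _ d).
transitivity (val (transported t1)).
  rewrite (transportedE fq); apply: homotopic_cover_class.
  apply: concat_homotopic; first exact: eq_homotopic.
  apply: homotopic_trans (homotopic_sym (concat_const_l _)) _.
  apply: concat_homotopic; last exact: eq_homotopic.
  by apply: homotopic_sym; exact: subpath_refl.
rewrite (path_in_fiber_constant T1 transported_continuous t1 zero).
rewrite (transportedE fp).
by apply: homotopic_cover_class; apply: homotopic_sym; exact: concatA.
Qed.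

End Lifts.

Theorem theorem2p2 (R : realType) (X : topologicalType) (x0 : X)
    (H : groupClosed (pi1 R x0)) :
  path_connected R X ->
  accessible_space (cover_fiber H x0) ->
  (forall (x : X) (beta : {path (unit_interval R) from x to x0}),
     continuous (monodromy H beta : cover_fiber H x -> cover_fiber H x0)) ->
  unique_path_lifting R (cover_proj H).
Proof.
move=> pcX T1 cphi f g cf cg fg fg0; apply/funext => t.
pose b s := cover_proj H (f s).
have cb : continuous b.
  exact: continuous_compose cf (@cover_proj_continuous _ _ _ H).
have gb s : cover_proj H (g s) = b s by rewrite /b -[RHS]/((_ \o _) s) fg.
have [d] := pcX (b t) x0.
have [p fp] := @lift_repr _ _ _ H b f (fun=> erefl) zero.
have gp := fp; rewrite fg0 in gp.
have phic s := cphi _ (concat (subpath cb s t) d).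
rewrite (@lift_endE _ _ _ H b cb f cf (fun=> erefl) t d phic T1 p fp).
by rewrite (@lift_endE _ _ _ H b cb g cg gb t d phic T1 p gp).
Qed.
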